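(* Let $(\alpha^e,\mathbf{0}_g)$ be an equilibrium point of the power network described in the context, with angle vector $\theta^e=((\alpha^e)^T,0)^T$, and let $\mathcal{E}_-$ be the set of critical lines of the active power flow graph $\mathcal{G}(\mathcal{V},\mathcal{E},\mathbf{W}(\theta^e))$. If the equilibrium point is hyperbolic and unstable, then it is a type-$m$ unstable equilibrium point, where $m$ is less than or equal to the number of critical lines, i.e. $m\le|\mathcal{E}_-|$.
   Context: Power network: a connected simple undirected graph with buses $\mathcal{V}=\{1,\dots,n\}$ and lines $\mathcal{E}$ ($l=|\mathcal{E}|$); $\mathcal{V}_G=\{1,\dots,g\}$ (generator internal buses), $\mathcal{V}_L=\{g+1,\dots,n\}$, $d=n-g$; constants $V_i>0$, $B_{ij}=B_{ji}>0$ for each line (purely inductive lines), $M_i>0$ for $i\in\mathcal{V}_G$, $D_i>0$ for all $i$, and $P_i\in\mathbb{R}$ with $\sum_iP_i=0$. With $\mathcal{N}_i$ the neighbours of $i$ and $\theta_{ij}=\theta_i-\theta_j$, the dynamics are $$M_i\ddot\theta_i+D_i\dot\theta_i=P_i-\sum_{j\in\mathcal{N}_i}V_iV_jB_{ij}\sin\theta_{ij}\ (i\in\mathcal{V}_G),\qquad D_i\dot\theta_i=P_i-\sum_{j\in\mathcal{N}_i}V_iV_jB_{ij}\sin\theta_{ij}\ (i\in\mathcal{V}_L).$$ Let $T=[\,I_{n-1}\ \ -\mathbf{1}_{n-1}\,]\in\mathbb{R}^{(n-1)\times n}$, $T_G,T_L$ its submatrices of columns indexed by $\mathcal{V}_G,\mathcal{V}_L$;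 states are $\alpha=T\theta$ and $\omega_G=\dot\theta_G$. An equilibrium point is $(\alpha^e,\mathbf{0}_g)$ such that $\theta^e=((\alpha^e)^T,0)^T$ satisfies $P_i=\sum_{j\in\mathcal{N}_i}V_iV_jB_{ij}\sin\theta^e_{ij}$ for all $i$. Active power flow graph $\mathcal{G}(\mathcal{V},\mathcal{E},\mathbf{W}(\theta))$: edge weights $w_{ij}=V_iV_jB_{ij}\cos\theta_{ij}$, forming the diagonal matrix $\mathbf{W}(\theta)\in\mathbb{R}^{l\times l}$; $L(\theta)=\mathbf{E}\mathbf{W}(\theta)\mathbf{E}^T$, with $\mathbf{E}$ the incidence matrix for an arbitrary orientation (column of an edge from $i$ to $j$: $1$ in row $i$, $-1$ in row $j$, $0$ elsewhere). A line $(i,j)$ is critical if $\pi/2<|\theta_i-\theta_j|\bmod 2\pi<3\pi/2$ (equivalently, its weight is negative). $F(\theta)$ is $L(\theta)$ with last row and column deleted. With $M=\mathrm{diag}(M_i)_{i\in\mathcal{V}_G}$, $D_G=\mathrm{diag}(D_i)_{i\in\mathcal{V}_G}$, $D_L=\mathrm{diag}(D_i)_{i\in\mathcal{V}_L}$, the linearization matrix at the equilibrium is $$J_{dyn}(\theta^e)=\begin{bmatrix}-T_LD_L^{-1}T_L^TF(\theta^e)&T_G\\-M^{-1}T_G^TF(\theta^e)&-M^{-1}D_G\end{bmatrix}.$$ Let $i_+(\cdot),i_0(\cdot)$ denote the number of eigenvalues with positive, respectively zero, real part. The equilibrium is hyperbolic if $i_0(J_{dyn}(\theta^e))=0$; a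 hyperbolic equilibrium is locally asymptotically stable if $i_+(J_{dyn}(\theta^e))=0$, and otherwise (unstable) it is a type-$m$ unstable equilibrium point with $m=i_+(J_{dyn}(\theta^e))$. *)

(* Defs.v *)
From HB Require Import structures.
From mathcomp Require Import all_boot all_order all_algebra.
From mathcomp Require Import complex.
From mathcomp Require Import all_classical all_reals all_analysis.

Set Implicit Arguments.
Unset Strict Implicit.
Unset Printing Implicit Defensive.

Import Order.TTheory GRing.Theory Num.Theory.
Local Open Scope ring_scope.

Section Spectrum.
Variable R : realType.

(* Complex eigenvalues of a real matrix, repeated according to their algebraic
   multiplicity. *)
Definition eigenvalues_seq (k : nat) (A : 'M[R]_k) : seq R[i] :=
  sval (closed_field_poly_normal (char_poly (map_mx (real_complex R) A))).

Lemma eigenvalues_seqP (k : nat) (A : 'M[R]_k) :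
  char_poly (map_mx (real_complex R) A) =
  \prod_(z <- eigenvalues_seq A) ('X - z%:P).
Proof.
rewrite /eigenvalues_seq; case: closed_field_poly_normal => s /= {1}->.
by rewrite (monicP (char_poly_monic _)) scale1r.
Qed.

Definition i_plus (k : nat) (A : 'M[R]_k) : nat :=
  count (fun z : R[i] => 0 < complex.Re z) (eigenvalues_seq A).

Definition i_zero (k : nat) (A : 'M[R]_k) : nat :=
  count (fun z : R[i] => complex.Re z == 0) (eigenvalues_seq A).

End Spectrum.

(* The representative of [x] in [0, y[, for y > 0. *)
Definition real_mod (R : realType) (x y : R) : R :=
  x - (Num.floor (x / y))%:~R * y.

(* The n = g + d buses form the type 'I_(g + d): the first g are the generator
   internal buses, embedded by [lshift d], and the last d are the load buses,
   embedded by [rshift g]. Values of [suscept] outside the lines are junk. *)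
Record power_network (R : realType) (g d : nat) := PowerNetwork {
  line : rel 'I_(g + d);
  volt : 'I_(g + d) -> R;
  suscept : 'I_(g + d) -> 'I_(g + d) -> R;
  inertia : 'I_g -> R;
  damping : 'I_(g + d) -> R;
  power : 'I_(g + d) -> R;
  bus_gt0 : (0 < g + d)%N;
  line_sym : symmetric line;
  line_irr : irreflexive line;
  line_connected : forall i j, connect line i j;
  volt_gt0 : forall i, 0 < volt i;
  suscept_sym : forall i j, line i j -> suscept i j = suscept j i;
  suscept_gt0 : forall i j, line i j -> 0 < suscept i j;
  inertia_gt0 : forall i, 0 < inertia i;
  damping_gt0 : forall i, 0 < damping i;
  power_balance : \sum_i power i = 0
}.

(* [O] contains exactly one of the two ordered pairs of each line, and nothing
   else. *)
Definition is_orientation (I : finType) (e : rel I) (O : {set I * I}) : Prop :=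
  (forall p, p \in O -> e p.1 p.2) /\
  (forall i j, e i j -> ((i, j) \in O) (+) ((j, i) \in O)).

Section PowerNetwork.
Variables (R : realType) (g d : nat) (N : power_network R g d).
Local Notation n := (g + d)%N.

(* theta = (alpha^T, 0)^T, where the last bus is the angle reference. *)
Definition theta_of (alpha : 'cV[R]_n.-1) : 'cV[R]_n :=
  \col_(i < n) oapp (fun k : 'I_n.-1 => alpha k 0) 0 (insub (val i)).

(* A state is a pair (alpha, omega_G). *)
Definition is_equilibrium (x : 'cV[R]_n.-1 * 'cV[R]_g) : Prop :=
  let theta := theta_of x.1 in
  x.2 = 0 /\
  forall i : 'I_n, power N i =
    \sum_(j | line N i j)
      volt N i * volt N j * suscept N i j * sin (theta i 0 - theta j 0).

Definition weight (theta : 'cV[R]_n) (i j : 'I_n) : R :=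
  volt N i * volt N j * suscept N i j * cos (theta i 0 - theta j 0).

Definition critical (theta : 'cV[R]_n) (i j : 'I_n) : bool :=
  pi / 2 < real_mod `|theta i 0 - theta j 0| (2 * pi) < 3 * pi / 2.

(* Lines are counted as unordered pairs {i, j}. *)
Definition critical_lines (theta : 'cV[R]_n) : {set {set 'I_n}} :=
  [set [set p.1; p.2] | p : 'I_n * 'I_n
     & line N p.1 p.2 && critical theta p.1 p.2].

Section Orientation.
(* The columns of the incidence matrix are indexed by the oriented lines. *)
Variable O : {set 'I_n * 'I_n}.

Definition incidence : 'M[R]_(n, #|O|) :=
  \matrix_(i < n, k < #|O|)
    ((i == (enum_val k).1)%:R - (i == (enum_val k).2)%:R).

Definition weight_mx (theta : 'cV[R]_n) : 'M[R]_#|O| :=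
  diag_mx (\row_(k < #|O|) weight theta (enum_val k).1 (enum_val k).2).

Definition laplacian (theta : 'cV[R]_n) : 'M[R]_n :=
  incidence *m weight_mx theta *m incidence^T.

Definition reduced_laplacian (theta : 'cV[R]_n) : 'M[R]_n.-1 :=
  mxsub (widen_ord (leq_pred n)) (widen_ord (leq_pred n)) (laplacian theta).

(* T = [I_(n-1), -1_(n-1)]. *)
Definition T_mx : 'M[R]_(n.-1, n) :=
  \matrix_(i < n.-1, j < n)
    (if val j == n.-1 then -1 else (val i == val j)%:R).

Definition T_G : 'M[R]_(n.-1, g) := lsubmx T_mx.
Definition T_L : 'M[R]_(n.-1, d) := rsubmx T_mx.

Definition M_mx : 'M[R]_g := diag_mx (\row_(i < g) inertia N i).
Definition D_G : 'M[R]_g := diag_mx (\row_(i < g) damping N (lshift d i)).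
Definition D_L : 'M[R]_d := diag_mx (\row_(i < d) damping N (rshift g i)).

Definition J_dyn (theta : 'cV[R]_n) : 'M[R]_(n.-1 + g) :=
  let F := reduced_laplacian theta in
  block_mx (- (T_L *m invmx D_L *m T_L^T *m F)) T_G
           (- (invmx M_mx *m T_G^T *m F)) (- (invmx M_mx *m D_G)).

Definition hyperbolic (x : 'cV[R]_n.-1 * 'cV[R]_g) : Prop :=
  is_equilibrium x /\ i_zero (J_dyn (theta_of x.1)) = 0%N.

Definition asymptotically_stable (x : 'cV[R]_n.-1 * 'cV[R]_g) : Prop :=
  hyperbolic x /\ i_plus (J_dyn (theta_of x.1)) = 0%N.

Definition hyperbolic_unstable (x : 'cV[R]_n.-1 * 'cV[R]_g) : Prop :=
  hyperbolic x /\ ~ asymptotically_stable x.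

Definition unstable_of_type (m : nat) (x : 'cV[R]_n.-1 * 'cV[R]_g) : Prop :=
  hyperbolic_unstable x /\ i_plus (J_dyn (theta_of x.1)) = m.

End Orientation.
End PowerNetwork.

(* Main.v *)
Require Import Defs.
From HB Require Import structures.
From mathcomp Require Import all_boot all_order all_algebra.
From mathcomp Require Import complex.
From mathcomp Require Import all_classical all_reals all_analysis.
From mathcomp Require Import zify lra.

Set Implicit Arguments.
Unset Strict Implicit.
Unset Printing Implicit Defensive.

Import Order.TTheory GRing.Theory Num.Theory.
Local Open Scope ring_scope.

(** Write [F] for the reduced Laplacian and [J] for the linearization, and
    consider the energy [H = diag(F, M)].  Damping makes it decrease along the
    linearized flow: [H J + J^T H = - B B^T], where [B] gathers the square roots
    of the friction terms.  So [H] is nonpositive on the unstable subspace of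
    [J].  It is even negative definite there: an eigenvector along which no
    energy is dissipated has zero frequencies and exerts no net force on any
    load bus, so that its [alpha] component does not move and its eigenvalue is
    zero ([swing_dissipative]).  On the other hand, [H] is a
    sum of the kinetic energy and of one square per line, weighted by the weight
    of that line; it is therefore nonnegative on the subspace where the angle
    differences across the critical lines vanish, whose codimension is at most
    the number of these lines.  A subspace on which [H] is negative definite
    meets this one trivially, so the dimension of the unstable subspace, which
    is [i_plus J], is at most the number of critical lines.

    The linear algebra is contained in [inertia_bound], which avoids generalized
    eigenspaces.  It removes the eigenvalues with positive real part one at
    a time: an eigenvector [e] for such an eigenvalue has negative energy, hence
    splits off orthogonally for the energy form, and all the hypotheses pass to
    the quotient by [e], which carries the Schur complement of the form
    ([dissipative_schur]).  Each removal lowers the dimension by one, while the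
    rank of a subspace of nonnegative energy is preserved
    ([rank_rsubmx_nneg]).

    Matrices act here on row vectors, so these lemmas are applied to [J^T]. *)

(** * Hermitian forms and dissipative pairs *)

Section Inertia.
Variable C : numClosedFieldType.
Local Open Scope sesquilinear_scope.

Lemma adjmxM m n p (A : 'M[C]_(m, n)) (B : 'M[C]_(n, p)) :
  (A *m B)^t* = B^t* *m A^t*.
Proof. by rewrite trmx_mul map_mxM. Qed.

Lemma adjmxK m n (A : 'M[C]_(m, n)) : (A^t*)^t* = A.
Proof. by apply/matrixP => i j; rewrite !mxE conjCK. Qed.

Definition herm_val n (S : 'M[C]_n) (v : 'rV_n) : C := (v *m S *m v^t*) 0 0.

Lemma sqnormE n (v : 'rV[C]_n) : (v *m v^t*) 0 0 = \sum_k `|v 0 k| ^+ 2.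
Proof. by rewrite mxE; apply: eq_bigr => k _; rewrite !mxE normCK. Qed.

Lemma sqnorm_ge0 n (v : 'rV[C]_n) : 0 <= (v *m v^t*) 0 0.
Proof. by rewrite sqnormE; apply: sumr_ge0 => k _; rewrite exprn_ge0. Qed.

Lemma sqnorm_eq0 n (v : 'rV[C]_n) : ((v *m v^t*) 0 0 == 0) = (v == 0).
Proof.
apply/idP/eqP => [|->]; last by rewrite mul0mx mxE.
rewrite sqnormE psumr_eq0 => [/allP v0|k _]; last by rewrite exprn_ge0.
apply/rowP => k; rewrite mxE; apply/eqP.
by have := v0 k (mem_index_enum k); rewrite /= sqrf_eq0 normr_eq0.
Qed.

(** [A *m S + S *m A^*] is the form [- |v B|^2] by which the energy
    [herm_val S] changes along the flow of [A].  The third clause is the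
    Popov-Belevitch-Hautus observability test, restricted to the eigenvalues
    with positive real part: no growing mode escapes dissipation. *)
Definition dissipative n p (A S : 'M[C]_n) (B : 'M[C]_(n, p)) : Prop :=
  [/\ S^t* = S,
      A *m S + S *m A^t* = - (B *m B^t*) &
      forall l (v : 'rV_n),
        0 < 'Re l -> v != 0 -> v *m A = l *: v -> v *m B != 0].

Lemma dissipative_conj n p (A S : 'M[C]_n) (B : 'M[C]_(n, p)) (Q : 'M[C]_n) :
  Q \in unitmx -> dissipative A S B ->
  dissipative (Q *m A *m invmx Q) (Q *m S *m Q^t*) (Q *m B).
Proof.
move=> uQ [hS lyap obs]; split.
- by rewrite !adjmxM adjmxK hS mulmxA.
- rewrite !mulmxA mulmxKV // !adjmxM !mulmxA.
  have -> : Q *m S *m Q^t* *m (invmx Q)^t* = Q *m S.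
    by rewrite -!mulmxA -adjmxM mulVmx // trmx1 map_mx1 mulmx1.
  rewrite -mulmxDl -!mulmxA -mulmxDr lyap.
  by rewrite mulmxN mulNmx -!mulmxA.
- move=> l v l0 v0 vA; rewrite mulmxA; apply: (obs l) => //.
    apply: contra v0 => /eqP vQ.
    by rewrite -(mulmxK uQ v) vQ mul0mx.
  by rewrite scalemxAl -vA !mulmxA mulmxKV.
Qed.

(** Evaluating the Lyapunov equation at [v] gives
    [2 (Re l) (herm_val S v) = - |v B|^2], and the right-hand side is not
    zero. *)
Lemma dissipative_eigen_lt0 n p (A S : 'M[C]_n) (B : 'M[C]_(n, p)) l v :
  dissipative A S B -> 0 < 'Re l -> v != 0 -> v *m A = l *: v ->
  herm_val S v < 0.
Proof.
move=> [hS lyap obs] l0 v0 vA.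
have : herm_val (A *m S + S *m A^t*) v = - herm_val (B *m B^t*) v.
  by rewrite lyap /herm_val mulmxN mulNmx mxE.
have -> : herm_val (B *m B^t*) v = ((v *m B) *m (v *m B)^t*) 0 0.
  by rewrite /herm_val adjmxM !mulmxA.
have -> : herm_val (A *m S + S *m A^t*) v = 'Re l * 2 * herm_val S v.
  rewrite /herm_val mulmxDr mulmxDl !mulmxA vA mxE.
  have -> : v *m S *m A^t* *m v^t* = v *m S *m (v *m A)^t*.
    by rewrite adjmxM !mulmxA.
  rewrite vA linearZ /= map_mxZ -!scalemxAl -scalemxAr !mxE -mulrDl.
  by rewrite ReE divfK // pnatr_eq0.
move=> E.
have : 'Re l * 2 * herm_val S v < 0.
  by rewrite E oppr_lt0 lt_def sqnorm_ge0 sqnorm_eq0 (obs l v).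
by rewrite pmulr_rlt0 // mulr_gt0.
Qed.

(** * Splitting off an eigenvector of negative energy *)

Definition first_vec n : 'rV[C]_(1 + n) := row_mx 1%:M 0.

Lemma first_vec_neq0 n : first_vec n != 0.
Proof.
apply/eqP => /(congr1 lsubmx); rewrite row_mxKl linear0.
by move/matrixP/(_ 0 0)/eqP; rewrite !mxE oner_eq0.
Qed.

Lemma first_vec_adj n : (first_vec n)^t* = col_mx 1%:M 0.
Proof. by rewrite tr_row_mx map_col_mx trmx1 map_mx1 trmx0 map_mx0. Qed.

Lemma first_vec_mul n m (X : 'M[C]_(1 + n, m)) : first_vec n *m X = usubmx X.
Proof.
by rewrite -{1}[X]vsubmxK mul_row_col mul1mx mul0mx addr0.
Qed.

Lemma herm_val_first n (S : 'M[C]_(1 + n)) : herm_val S (first_vec n) = S 0 0.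
Proof.
rewrite /herm_val first_vec_mul first_vec_adj -[usubmx S]hsubmxK mul_row_col.
rewrite mulmx1 mulmx0 addr0 !mxE; congr (S _ _); exact: val_inj.
Qed.

(** The situation after the change of basis that makes the first basis vector an
    eigenvector of [A].  The quotient by that vector is identified with its
    [S]-orthogonal complement, on which [A] induces [drsubmx A]. *)
Section Deflation.
Variables (n p : nat) (A S : 'M[C]_(1 + n)) (B : 'M[C]_(1 + n, p)) (l : C).
Hypothesis AE : A = block_mx l%:M 0 (dlsubmx A) (drsubmx A).
Let s : C := S 0 0.
Let b : 'cV_n := dlsubmx S.
Hypothesis s_lt0 : s < 0.
Hypothesis hS : S^t* = S.

(** The rows span the [S]-orthogonal complement of the first basis vector:
    row [i] is the only vector of that complement that agrees with the [i]-th
    remaining basis vector modulo the first one. *)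
Definition schur_lift : 'M[C]_(n, 1 + n) := row_mx (- s^-1 *: b) 1%:M.
Definition schur_compl : 'M[C]_n := drsubmx S - s^-1 *: (b *m b^t*).

Let SE : S = block_mx s%:M (b^t*) b (drsubmx S).
Proof.
rewrite -[LHS]submxK; congr block_mx.
  by rewrite [LHS]mx11_scalar !mxE; congr (S _ _)%:M; apply: val_inj.
by rewrite -{1}hS; apply/matrixP => i j; rewrite !mxE.
Qed.

Let s_neq0 : s != 0. Proof. by rewrite lt_eqF. Qed.

Lemma schur_lift_mul : schur_lift *m S = row_mx 0 schur_compl.
Proof.
rewrite /schur_lift [in LHS]SE mul_row_block mul1mx mul1mx.
rewrite mul_mx_scalar scalerA mulrN mulfV // scaleN1r addNr.
by rewrite -scalemxAl scaleNr addrC.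
Qed.

Lemma schur_complE : schur_lift *m S *m schur_lift^t* = schur_compl.
Proof.
rewrite schur_lift_mul /schur_lift tr_row_mx map_col_mx mul_row_col mul0mx.
by rewrite add0r trmx1 map_mx1 mulmx1.
Qed.

Lemma schur_compl_herm : schur_compl^t* = schur_compl.
Proof. by rewrite -schur_complE !adjmxM adjmxK hS mulmxA. Qed.

Lemma schur_lift_dyn :
  schur_lift *m A *m S *m schur_lift^t* = drsubmx A *m schur_compl.
Proof.
rewrite -mulmxA -[S *m _]adjmxK adjmxM adjmxK hS schur_lift_mul.
rewrite tr_row_mx map_col_mx schur_compl_herm trmx0 map_mx0.
rewrite /schur_lift AE mul_row_block !mulmx0 !mul1mx add0r.
by rewrite mul_row_col mulmx0 add0r block_mxKdr.
Qed.

(** The energy of [v] is that of its component in the [S]-orthogonal complement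
    plus that of its component along the first basis vector, and the latter is
    nonpositive. *)
Lemma herm_val_schur (v : 'rV[C]_(1 + n)) :
  herm_val S v <= herm_val schur_compl (rsubmx v).
Proof.
pose v2 := rsubmx v.
pose t := v 0 0 + s^-1 * (v2 *m b) 0 0.
pose e := first_vec n.
(* [t] is the coordinate of [v] along [e] in the [S]-orthogonal splitting. *)
have ve : v = t *: e + v2 *m schur_lift.
  rewrite -[LHS]hsubmxK /schur_lift mul_mx_row scale_row_mx add_row_mx mulmx1.
  rewrite scaler0 add0r; congr row_mx.
  rewrite [LHS]mx11_scalar [X in _ = _ + X]mx11_scalar !scalemx1 -raddfD /=.
  congr (_%:M); rewrite /t -scalemxAr !mxE.
  have -> : v 0 (lshift n 0) = v 0 0 by congr (v _ _); apply: val_inj.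
  by rewrite mulNr addrK.
have -> : herm_val S v = s * `|t| ^+ 2 + herm_val schur_compl v2.
  rewrite /herm_val {1 2}ve.
  have L0 : schur_lift *m S *m e^t* = 0.
    by rewrite schur_lift_mul first_vec_adj mul_row_col mul0mx mulmx0 addr0.
  have eL0 : e *m S *m schur_lift^t* = 0.
    by rewrite -[LHS]adjmxK adjmxM (adjmxM e) adjmxK hS mulmxA L0 trmx0 map_mx0.
  have eSe : (e *m S *m e^t*) 0 0 = s := herm_val_first S.
  rewrite [in X in _ *m X]linearD map_mxD /= linearZ map_mxZ /= adjmxM.
  rewrite mulmxDl mulmxDr !mulmxDl -!scalemxAl -!scalemxAr.
  have -> : v2 *m schur_lift *m S *m e^t* = 0.
    by rewrite -mulmxA -mulmxA [X in v2 *m X]mulmxA L0 mulmx0.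
  have -> : v2 *m schur_lift *m S *m (schur_lift^t* *m v2^t*) =
            v2 *m schur_compl *m v2^t* by rewrite -schur_complE !mulmxA.
  rewrite mulmxA eL0 mul0mx !scaler0 addr0 add0r mxE; congr (_ + _).
  by rewrite scalerA mxE eSe normCK mulrC.
by rewrite gerDr nmulr_rle0 // exprn_ge0.
Qed.

(** The Lyapunov equation is obtained by restriction to the complement.  For
    the observability clause, an eigenvector [y] of the quotient lifts to [z]
    with [z A = m z + c e], where [e] is the first basis vector.  If [z] dissipates
    nothing then pairing the Lyapunov equation for [z] with [e] gives [c = 0],
    because [z] is [S]-orthogonal to the eigenvector [e] while
    [herm_val S e <> 0].  So [z] is an undamped eigenvector of [A] itself. *)
Lemma dissipative_schur : dissipative A S B ->
  dissipative (drsubmx A) schur_compl (schur_lift *m B).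
Proof.
move=> [_ lyap obs].
have dynE := schur_lift_dyn.
have dynE' : schur_compl *m (drsubmx A)^t* =
             schur_lift *m S *m A^t* *m schur_lift^t*.
  rewrite -{1}schur_compl_herm -adjmxM -dynE !adjmxM !adjmxK hS.
  by rewrite !mulmxA.
split; first exact: schur_compl_herm.
  rewrite -dynE dynE' -mulmxDl -!mulmxA -mulmxDr lyap mulmxN mulNmx.
  by rewrite adjmxM !mulmxA.
move=> m y m0 y0 yA; apply/negP => /eqP yB.
pose z := y *m schur_lift.
have zB : z *m B = 0 by rewrite -mulmxA.
pose e := first_vec n.
have z0 : z != 0.
  apply: contra y0 => /eqP /(congr1 rsubmx).
  by rewrite /z /schur_lift mul_mx_row mulmx1 row_mxKr linear0 => ->.
have zSe : z *m S *m e^t* = 0.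
  rewrite -mulmxA /z -mulmxA [X in y *m X]mulmxA schur_lift_mul first_vec_adj.
  by rewrite mul_row_col mul0mx mulmx0 addr0 mulmx0.
have eA : e *m A = l *: e.
  rewrite /e first_vec_mul AE block_mxEv col_mxKu /first_vec scale_row_mx.
  by rewrite scalemx1 scaler0.
have zAr : rsubmx (z *m A) = m *: y.
  rewrite /z -mulmxA /schur_lift AE mul_row_block !mulmx0 !mul1mx add0r.
  by rewrite mul_mx_row row_mxKr yA.
have [c zA] : exists c, z *m A = m *: z + c *: e.
  exists (lsubmx (z *m A) 0 0 - m * lsubmx z 0 0).
  have zE : z = row_mx (lsubmx z) y.
    rewrite -[LHS]hsubmxK; congr row_mx.
    by rewrite /z /schur_lift mul_mx_row mulmx1 row_mxKr.
  rewrite -[LHS]hsubmxK zAr [in m *: z]zE.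
  rewrite /e !scale_row_mx add_row_mx scaler0 addr0; congr row_mx.
  move: (lsubmx (z *m A)) (lsubmx z) => X Y.
  by apply/rowP => j; rewrite !ord1 !mxE mulr1 addrC subrK.
have c0 : c = 0.
  have : z *m (A *m S + S *m A^t*) *m e^t* = 0.
    by rewrite lyap mulmxN mulmxA zB mul0mx oppr0 mul0mx.
  have -> : z *m (A *m S + S *m A^t*) *m e^t* =
     z *m A *m S *m e^t* + z *m S *m (e *m A)^t*.
    by rewrite adjmxM mulmxDr mulmxDl !mulmxA.
  rewrite eA linearZ /= map_mxZ -scalemxAr zSe scaler0 addr0 zA.
  rewrite !mulmxDl -!scalemxAl zSe scaler0 add0r => /matrixP /(_ 0 0).
  rewrite mxE.
  have -> : (e *m S *m e^t*) 0 0 = s := herm_val_first S.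
  by rewrite mxE => /eqP; rewrite mulf_eq0 (negPf s_neq0) orbF => /eqP.
by move: (obs m z m0 z0); rewrite zA c0 scale0r addr0 zB eqxx => /(_ erefl).
Qed.

End Deflation.

(** * Counting the eigenvalues with positive real part *)

Lemma char_poly_conj n (A Q : 'M[C]_n) :
  Q \in unitmx -> char_poly (Q *m A *m invmx Q) = char_poly A.
Proof.
move=> uQ; have QK : map_mx polyC Q *m map_mx polyC (invmx Q) = 1%:M.
  by rewrite -map_mxM mulmxV // map_mx1.
have -> : char_poly (Q *m A *m invmx Q) =
    \det (map_mx polyC Q *m char_poly_mx A *m map_mx polyC (invmx Q)).
  congr (\det _); rewrite /char_poly_mx mulmxBr mulmxBl !map_mxM.
  by rewrite mul_mx_scalar -scalemxAl QK scalemx1.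
by rewrite !det_mulmx mulrAC -det_mulmx QK det1 mul1r.
Qed.

Lemma char_poly_lblock m n (A : 'M[C]_m) (D : 'M[C]_(n, m)) (E : 'M[C]_n) :
  char_poly (block_mx A 0 D E) = char_poly A * char_poly E.
Proof.
rewrite /char_poly -(det_lblock _ (- map_mx polyC D)); congr (\det _).
rewrite /char_poly_mx map_block_mx map_mx0 (scalar_mx_block m n 'X).
by rewrite opp_block_mx add_block_mx oppr0 !add0r.
Qed.

(** The first row of [row_ebase v] is a multiple of [v], so it serves as the new
    basis. *)
Lemma eigenvector_conj_block n (A : 'M[C]_(1 + n)) l (v : 'rV_(1 + n)) :
  v != 0 -> v *m A = l *: v ->
  exists2 Q, Q \in unitmx & let A' := Q *m A *m invmx Q in
    A' = block_mx l%:M 0 (dlsubmx A') (drsubmx A').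
Proof.
move=> v0 vA; exists (row_ebase v); first exact: row_ebase_unit.
set Q := row_ebase v; set A' := Q *m A *m invmx Q.
pose e := first_vec n.
pose c := col_ebase v 0 0.
have vE : v = c *: (e *m Q).
  rewrite -[LHS]mulmx_ebase rank_rV v0 [col_ebase v]mx11_scalar -mulmxA.
  rewrite mul_scalar_mx.
  congr (_ *: (_ *m _)).
  exact: pid_mx_row.
have c0 : c != 0 by apply: contra v0 => /eqP c0; rewrite vE c0 scale0r.
have eQA : e *m A' = l *: e.
  apply: (can_inj (mulmxK (row_ebase_unit v))); apply: (scalerI c0).
  rewrite -/Q /A' !mulmxA mulmxKV ?row_ebase_unit // -!scalemxAl.
  by rewrite scalerA mulrC -scalerA -vE -vA scalemxAl -vE.
move: eQA; rewrite /= -[in e *m A'](submxK A') /e mul_row_block.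
rewrite !mul1mx !mul0mx !addr0 scale_row_mx scaler0 scalemx1.
move=> /eq_row_mx [<- <-].
by rewrite submxK.
Qed.

(** A combination of rows of [W] that vanishes outside the first coordinate is
    [c *: first_vec n], of energy [|c|^2 S00]; it has to be zero if energies are
    nonnegative on [W].  So no rank is lost in the quotient by the first
    vector. *)
Lemma rank_rsubmx_nneg n (S W : 'M[C]_(1 + n)) :
  S 0 0 < 0 ->
  (forall v : 'rV_(1 + n), (v <= W)%MS -> 0 <= herm_val S v) ->
  (\rank W <= \rank (rsubmx W))%N.
Proof.
move=> S00 posW.
have : (kermx (rsubmx W) <= kermx W)%MS.
  apply/row_subP => i; apply/sub_kermxP.
  set x := row i _.
  have xW : x *m rsubmx W = 0 by apply/sub_kermxP; exact: row_sub.
  have wE : x *m W = lsubmx (x *m W) 0 0 *: first_vec n.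
    rewrite -[LHS]hsubmxK -mulmx_rsub xW {1}[lsubmx _]mx11_scalar.
    by rewrite /first_vec scale_row_mx scalemx1 scaler0.
  have := posW _ (submxMl x W); rewrite wE; move: (lsubmx _ _ _) => c.
  rewrite /herm_val linearZ /= map_mxZ -!scalemxAl -scalemxAr scalerA mxE.
  rewrite -normCK -/(herm_val S _) herm_val_first nmulr_lge0 // => c0.
  suff -> : c = 0 by rewrite scale0r.
  apply/eqP; rewrite -normr_eq0 -sqrf_eq0 eq_le c0 /=.
  by rewrite exprn_ge0.
move=> /mxrankS; rewrite !mxrank_ker; have := rank_leq_row W.
by have := rank_leq_row (rsubmx W); lia.
Qed.

(** The spectrum is given as a list [s] so that the induction on [n] can remove
    one of its entries together with an eigenvector for it.  When no entry of
    positive real part is left, the bound is the one on the rank of [U]. *)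
Lemma inertia_bound n p (A S : 'M[C]_n) (B : 'M[C]_(n, p)) (U : 'M[C]_n)
    (s : seq C) :
  dissipative A S B ->
  (forall v : 'rV_n, (v <= U)%MS -> 0 <= herm_val S v) ->
  char_poly A = \prod_(z <- s) ('X - z%:P) ->
  (count (fun z => 0 < 'Re z)%R s + \rank U <= n)%N.
Proof.
elim: n => [|n IHn] in A S B U s *.
  move=> _ _ As; rewrite [U]thinmx0 mxrank0 addn0.
  have := size_char_poly A; rewrite As size_prod_XsubC => -[/size0nil ->] //.
move=> diss posU As.
case/boolP: (has (fun z => 0 < 'Re z) s); last first.
  by rewrite has_count -leqNgt leqn0 => /eqP ->; exact: rank_leq_row.
case/hasP => l ls l0.
have : eigenvalue A l by rewrite eigenvalue_root_char As root_prod_XsubC.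
case/eigenvalueP => v vA v0.
(* In the basis given by [Q] the first vector is an eigenvector for [l]. *)
have [Q uQ] := eigenvector_conj_block (n := n) v0 vA; cbv zeta.
have dissQ := dissipative_conj uQ diss.
have AQs := char_poly_conj A uQ.
set A' := Q *m A *m _ in dissQ AQs *; move=> A'E.
set S' := Q *m S *m _ in dissQ.
have hS' : S'^t* = S' by case: dissQ.
have S'00 : S' 0 0 < 0.
  rewrite -herm_val_first; apply: (dissipative_eigen_lt0 dissQ l0).
    exact: first_vec_neq0.
  rewrite first_vec_mul A'E block_mxEv col_mxKu /first_vec scale_row_mx.
  by rewrite scalemx1 scaler0.
(* [U'] is the image of [U] in the quotient by that vector. *)
have [U' posU' rU'] : exists2 U' : 'M[C]_n,
   (forall v : 'rV_n, (v <= U')%MS -> 0 <= herm_val (schur_compl S') v) &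
   (\rank U <= \rank U')%N.
  pose W : 'M[C]_(1 + n) := U *m invmx Q.
  have posW (w : 'rV_(1 + n)) : (w <= W)%MS -> 0 <= herm_val S' w.
    move=> wW; have -> : herm_val S' w = herm_val S (w *m Q).
      by rewrite /herm_val /S' adjmxM !mulmxA.
    apply: posU; rewrite -(mulmxKV uQ U); exact: submxMr.
  exists (<<rsubmx W>>)%MS => [w|].
    rewrite genmxE => /submxP [x ->].
    rewrite mulmx_rsub; apply: le_trans (herm_val_schur S'00 hS' _).
    by apply: posW; exact: submxMl.
  rewrite genmxE.
  have -> : \rank U = \rank W.
    by rewrite mxrankMfree // row_free_unit unitmx_inv.
  exact: rank_rsubmx_nneg posW.
have As' : char_poly (drsubmx A') = \prod_(z <- rem l s) ('X - z%:P).
  apply: (mulfI (negbT (polyXsubC_eq0 l))).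
  rewrite -(big_cons 1 _ _ _ xpredT (fun z => 'X - z%:P)).
  rewrite -(perm_big _ (perm_to_rem ls)) /=.
  rewrite -As -AQs [in RHS]A'E.
  rewrite [RHS](char_poly_lblock (m := 1) (n := n) l%:M (dlsubmx A')
    (drsubmx A')).
  by rewrite [char_poly l%:M]det_mx11 !mxE eqxx !mulr1n.
have := IHn _ _ _ U' _ (dissipative_schur A'E S'00 hS' dissQ) posU' As'.
rewrite (permP (perm_to_rem ls)) /= l0 => IH.
by rewrite add1n addSn ltnS (leq_trans _ IH) // leq_add2l.
Qed.
End Inertia.

(** * The linearized swing equations are dissipative *)

Section Swing.
Variables (R : realType).
Local Open Scope sesquilinear_scope.
Local Notation toC := (map_mx (real_complex R)).

Lemma adj_real_mx m n (X : 'M[R]_(m, n)) : (toC X)^t* = toC X^T.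
Proof.
apply/matrixP => i j; rewrite !mxE; apply/CrealP.
by rewrite complex_real.
Qed.

Lemma real_mx_unit_eq0 m n (X : 'M[R]_n) (V : 'M[R[i]]_(m, n)) :
  X \in unitmx -> V *m toC X = 0 -> V = 0.
Proof.
move=> uX V0; have uX' : toC X \in unitmx by rewrite map_unitmx.
by rewrite -(mulmxK uX' V) V0 mul0mx.
Qed.

(** [F], [M], [DG] and [K] stand for the stiffness, the inertia, the generator
    damping and the load mobility (the inverse of the load damping).
    The two coupling blocks [F TG] and [- TG^T F] of [H J] are opposite
    transposes, so that only the friction terms remain in [H J + J^T H].  A mode
    [(a, w)] without dissipation has [w = 0] and [a F TL = 0]; then the first
    block of its image under [J] is zero, which forces [a = 0] if the
    eigenvalue is not zero. *)
Lemma swing_dissipative k g d (F : 'M[R]_k) (TG : 'M[R]_(k, g))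
    (TL : 'M[R]_(k, d)) (M DG E2 : 'M[R]_g) (K E1 : 'M[R]_d) :
  F^T = F -> M^T = M -> M \in unitmx ->
  E1 \in unitmx -> E1 *m E1^T = K + K^T ->
  E2 \in unitmx -> E2 *m E2^T = DG + DG^T ->
  let J := block_mx (- (TL *m K *m TL^T *m F)) TG
                    (- (invmx M *m TG^T *m F)) (- (invmx M *m DG)) in
  dissipative (toC J^T) (toC (block_mx F 0 0 M))
    (toC (block_mx (F *m TL *m E1) 0 0 E2)).
Proof.
move=> hF hM uM uE1 E1K uE2 E2D J.
pose H := block_mx F 0 0 M.
have HJ : H *m J = block_mx (- (F *m TL *m K *m TL^T *m F)) (F *m TG)
                            (- (TG^T *m F)) (- DG).
  rewrite /H /J mulmx_block !mul0mx !addr0 !add0r !mulmxN !mulmxA.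
  by rewrite mulmxV // !mul1mx.
have hH : H^T = H by rewrite /H tr_block_mx hF hM !trmx0.
split.
- by rewrite adj_real_mx -/H hH.
- rewrite !adj_real_mx trmxK -!map_mxM -map_mxD -map_mxN; congr (toC _).
  have -> : J^T *m block_mx F 0 0 M = (H *m J)^T by rewrite trmx_mul hH.
  rewrite -/H HJ !tr_block_mx add_block_mx mulmx_block opp_block_mx.
  rewrite !trmx0 !mulmx0 !mul0mx !addr0 !add0r.
  congr block_mx.
  + rewrite !trmx_mul !linearN /= !trmx_mul trmxK hF -!mulmxA -opprD.
    congr (- _).
    rewrite (mulmxA E1) E1K mulmxDl !mulmxDr addrC.
    by congr (_ + _); rewrite !mulmxA.
  + by rewrite linearN /= trmx_mul trmxK hF oppr0 addNr.
  + by rewrite trmx_mul hF oppr0 addrN.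
  + by rewrite linearN /= E2D opprD addrC.
- move=> l v l0 v0 vJ; apply/negP => /eqP vB.
  have := vB; rewrite -[v]hsubmxK map_block_mx !map_mx0 mul_row_block !mulmx0.
  rewrite addr0 add0r -[0]hsubmxK !linear0 => /eq_row_mx [].
  rewrite !map_mxM mulmxA.
  move=> /(real_mx_unit_eq0 uE1) aFT /(real_mx_unit_eq0 uE2) w0.
  move: vJ; rewrite -[v]hsubmxK w0 tr_block_mx map_block_mx mul_row_block.
  rewrite !mul0mx !addr0 scale_row_mx scaler0 => /eq_row_mx [aE _].
  have l_neq0 : l != 0 by apply: contraTneq l0 => ->; rewrite raddf0 ltxx.
  have a0 : lsubmx v = 0.
    apply: (scalerI l_neq0); rewrite -aE scaler0 linearN /= map_mxN mulmxN.
    rewrite !trmx_mul trmxK hF !map_mxM !mulmxA; rewrite mulmxA in aFT.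
    by rewrite aFT !mul0mx oppr0.
  by move: v0; rewrite -[v]hsubmxK a0 w0 row_mx0 eqxx.
Qed.
End Swing.

(** * The energy form as a weighted sum of squares *)

Section Energy.
Variable C : numClosedFieldType.
Local Open Scope sesquilinear_scope.

Lemma herm_val_block_diag m n (X : 'M[C]_m) (Y : 'M[C]_n) (v : 'rV[C]_(m + n)) :
  herm_val (block_mx X 0 0 Y) v = herm_val X (lsubmx v) + herm_val Y (rsubmx v).
Proof.
rewrite /herm_val -{1 2}[v]hsubmxK tr_row_mx map_col_mx mul_row_block.
by rewrite mul_row_col !mulmx0 addr0 add0r mxE.
Qed.

Lemma herm_val_diag n (w v : 'rV[C]_n) :
  herm_val (diag_mx w) v = \sum_k w 0 k * `|v 0 k| ^+ 2.
Proof.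
rewrite /herm_val mul_mx_diag mxE; apply: eq_bigr => k _.
by rewrite !mxE normCK mulrAC mulrC.
Qed.

Lemma herm_val_congr m n (X : 'M[C]_m) (G : 'M[C]_(n, m)) (v : 'rV[C]_n) :
  herm_val (G *m X *m G^t*) v = herm_val X (v *m G).
Proof. by rewrite /herm_val adjmxM !mulmxA. Qed.

End Energy.

(** * Lines of negative weight are critical *)

Section Angles.
Variable R : realType.

Lemma cos_real_mod (x : R) : 0 <= x -> cos (real_mod x (2 * pi)) = cos x.
Proof.
move=> x0; rewrite /real_mod.
have pi2 : 0 < 2 * pi :> R by rewrite mulr_gt0 ?pi_gt0.
have : 0 <= Num.floor (x / (2 * pi)) by rewrite floor_ge0 divr_ge0 // ltW.
case: (Num.floor _) => // m _.
rewrite -[LHS](periodicn (@cosD2pi R) m) -pmulrn mulr_natl mulr_natl.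
by rewrite subrK.
Qed.

Lemma real_mod_itv (x y : R) : 0 < y -> 0 <= real_mod x y < y.
Proof.
move=> y0; rewrite /real_mod subr_ge0 ltrBlDl -ler_pdivlMr //.
rewrite floor_le /=.
have := floorD1_gt (x / y); rewrite ltr_pdivrMr // => /lt_le_trans; apply.
by rewrite intrD mulrDl mul1r.
Qed.

Lemma cos_lt0_real_mod (x : R) : cos x < 0 ->
  pi / 2 < real_mod `|x| (2 * pi) < 3 * pi / 2.
Proof.
rewrite -cos_norm -cos_real_mod //.
have p0 := pi_gt0 R.
have /andP[] : 0 <= real_mod `|x| (2 * pi) < 2 * pi.
  by apply: real_mod_itv; lra.
move: (real_mod _ _) => y y0 y2 cy.
apply/andP; split; rewrite ltNge; apply/negP => hy;
  suff : 0 <= cos y by rewrite leNgt cy.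
  by apply: cos_ge0_pihalf; lra.
rewrite -[y](subrK (pi *+ 2)) cosD2pi; apply: cos_ge0_pihalf.
by rewrite (mulr2n pi); lra.
Qed.
End Angles.

(** An unordered line is hit by one oriented line only, since an orientation
    never contains both [(i, j)] and [(j, i)]. *)
Lemma count_negative_lines (R : realType) (g d : nat) (N : power_network R g d)
    (O : {set 'I_(g + d) * 'I_(g + d)}) (theta : 'cV[R]_(g + d)) :
  is_orientation (line N) O ->
  (#|[set k : 'I_#|O| | (weight_mx N O theta k k < 0)%R]| <=
   #|critical_lines N theta|)%N.
Proof.
move=> [Oline Oxor].
pose f (k : 'I_#|O|) := [set (enum_val k).1; (enum_val k).2].
rewrite -(card_in_imset (f := f)); last first.
  move=> k k' _ _; rewrite /f => E; apply: enum_val_inj.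
  have := Oline _ (enum_valP k); have := Oline _ (enum_valP k').
  move: (enum_valP k) (enum_valP k') E.
  case: (enum_val k) => i j; case: (enum_val k') => i' j' /=.
  move=> Oij Oij' E lij' lij.
  have ij : i != j by apply: contraTneq lij => ->; rewrite line_irr.
  have: i \in [set i'; j'] by rewrite -E set21.
  have: j \in [set i'; j'] by rewrite -E set22.
  rewrite !inE => /orP[] /eqP ej /orP[] /eqP ei; subst;
    rewrite ?eqxx // in ij *.
  by have := Oxor _ _ lij; rewrite Oij Oij'.
apply: subset_leq_card; apply/fintype.subsetP => _ /imsetP[k + ->].
rewrite inE mxE eqxx mulr1n mxE /weight => wk.
apply/imsetP; exists (enum_val k) => //.
have lk := Oline _ (enum_valP k).
rewrite inE lk /=; apply: cos_lt0_real_mod.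
by move: wk; rewrite pmulr_rlt0 // !mulr_gt0 ?volt_gt0 ?suscept_gt0.
Qed.

(** * The number of unstable modes *)

Section Main.
Variables (R : realType) (g d : nat) (N : power_network R g d).
Local Open Scope sesquilinear_scope.
Local Notation toC := (map_mx (real_complex R)).

Lemma diag_mx_unit (K : fieldType) n (r : 'rV[K]_n) :
  (forall i, r 0 i != 0) -> diag_mx r \in unitmx.
Proof.
by move=> r0; rewrite unitmxE det_diag unitfE; apply/prodf_neq0 => i _.
Qed.

Lemma invmx_diag (K : fieldType) n (r : 'rV[K]_n) :
  (forall i, r 0 i != 0) -> invmx (diag_mx r) = diag_mx (map_mx GRing.inv r).
Proof.
move=> r0; have u := diag_mx_unit r0.
apply: (can_inj (mulKmx u)); rewrite mulmxV // mulmx_diag.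
by apply/matrixP => i j; rewrite !mxE mulfV.
Qed.

(** Supplies the factors [E1] and [E2] of [swing_dissipative]; the constant 2
    is there because [r] is symmetrized. *)
Lemma sqrt_diag_factor n (r : 'rV[R]_n) : (forall i, 0 < r 0 i) ->
  let E := diag_mx (map_mx (fun x => Num.sqrt (2 * x)) r) in
  E \in unitmx /\ E *m E^T = diag_mx r + (diag_mx r)^T.
Proof.
move=> r0 E; split.
  by apply: diag_mx_unit => i; rewrite mxE gt_eqF // sqrtr_gt0 mulr_gt0.
rewrite !tr_diag_mx mulmx_diag -linearD /=; congr diag_mx; apply/rowP => i.
by rewrite !mxE -expr2 sqr_sqrtr ?mulr_ge0 ?ltW // mulr_natl mulr2n.
Qed.

Lemma char_poly_tr (K : comNzRingType) n (A : 'M[K]_n) :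
  char_poly A^T = char_poly A.
Proof.
rewrite /char_poly -det_tr /char_poly_mx; congr (\det _).
by rewrite linearB /= tr_scalar_mx map_trmx trmxK.
Qed.

Lemma i_plusE n (A : 'M[R]_n) :
  i_plus A = count (fun z => 0 < 'Re z) (eigenvalues_seq A).
Proof. by apply: eq_count => z; rewrite -complexRe ltcR. Qed.

Variables (O : {set 'I_(g + d) * 'I_(g + d)}) (theta : 'cV[R]_(g + d)).
Let n := (g + d)%N.
Let red_inc : 'M[R]_(n.-1, #|O|) :=
  rowsub (widen_ord (leq_pred n)) (incidence R O).

Lemma reduced_laplacianE :
  reduced_laplacian N O theta = red_inc *m weight_mx N O theta *m red_inc^T.
Proof.
rewrite /reduced_laplacian /laplacian mxsub_mul -trmx_mxsub.
by congr (_ *m _); rewrite (mxsub_mul _ id) mxsub_id.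
Qed.

(** [inertia_bound] is applied to the kernel of [Cm], whose columns send a state
    to its angle differences across the lines of negative weight; there
    the stiffness form is a sum of squares with nonnegative weights. *)
Lemma i_plus_J_dyn :
  (i_plus (J_dyn N O theta) <=
   #|[set k : 'I_#|O| | (weight_mx N O theta k k < 0)%R]|)%N.
Proof.
set crit := [set k | _].
pose F := reduced_laplacian N O theta.
have hF : F^T = F.
  by rewrite /F reduced_laplacianE !trmx_mul trmxK tr_diag_mx mulmxA.
have M0 i : 0 < (\row_(i < g) inertia N i) 0 i by rewrite mxE inertia_gt0.
have DG0 i : 0 < (\row_(i < g) damping N (lshift d i)) 0 i.
  by rewrite mxE damping_gt0.
have DL0 i : 0 < (\row_(i < d) damping N (rshift g i)) 0 i.
  by rewrite mxE damping_gt0.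
have DL1 i : 0 < (map_mx GRing.inv (\row_(i < d) damping N (rshift g i))) 0 i.
  by rewrite mxE invr_gt0.
have nz m (r : 'rV[R]_m) : (forall i, 0 < r 0 i) -> forall i, r 0 i != 0.
  by move=> r0 i; rewrite gt_eqF.
have [uE1 E1E] := sqrt_diag_factor DL1.
have [uE2 E2E] := sqrt_diag_factor DG0.
have := @swing_dissipative R _ _ _ F (T_G R g d) (T_L R g d) (M_mx N) (D_G N) _
  _ _ hF (tr_diag_mx _) (diag_mx_unit (nz _ _ M0)) uE1 E1E uE2 E2E.
rewrite -invmx_diag; last exact: nz.
cbv zeta; rewrite -/(D_L N) -/(J_dyn N O theta) => diss.
pose sel : 'M[R]_(#|O|, #|crit|) := \matrix_(k, i) (k == enum_val i)%:R.
pose Cm : 'M[R]_(n.-1 + g, #|crit|) := col_mx (red_inc *m sel) 0.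
have pos (v : 'rV[R[i]]_(n.-1 + g)) :
    (v <= kermx (toC Cm))%MS -> 0 <= herm_val (toC (block_mx F 0 0 (M_mx N))) v.
  move/sub_kermxP; rewrite -{1}[v]hsubmxK map_col_mx mul_row_col map_mx0 mulmx0.
  rewrite addr0 map_mxM mulmxA => v0.
  rewrite map_block_mx !map_mx0 herm_val_block_diag.
  apply: addr_ge0; last first.
    rewrite map_diag_mx herm_val_diag; apply: sumr_ge0 => k _.
    by rewrite mulr_ge0 ?exprn_ge0 // !mxE ler0c ltW ?inertia_gt0.
  rewrite /F reduced_laplacianE !map_mxM -adj_real_mx herm_val_congr.
  rewrite map_diag_mx herm_val_diag; apply: sumr_ge0 => k _.
  have [wk|wk] := ltP (weight_mx N O theta k k) 0.
    have kc : k \in crit by rewrite inE.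
    suff -> : (lsubmx v *m toC red_inc) 0 k = 0 by rewrite normr0 expr0n mulr0.
    have := congr1 (fun X : 'rV_(_) => X 0 (enum_rank_in kc k)) v0.
    rewrite /= mxE (bigD1 k) //= big1 => [|j jk].
      by rewrite !mxE enum_rankK_in // eqxx rmorph1 mulr1 addr0.
    by rewrite !mxE enum_rankK_in // (negPf jk) rmorph0 mulr0.
  move: wk; rewrite !mxE eqxx mulr1n => wk.
  by rewrite mulr_ge0 ?exprn_ge0 // ler0c.
have := inertia_bound diss pos (s := eigenvalues_seq (J_dyn N O theta)).
rewrite -i_plusE -map_trmx char_poly_tr => /(_ (eigenvalues_seqP _)).
rewrite mxrank_ker addnBA ?rank_leq_row // leq_subLR leq_add2r => bound.
exact: leq_trans bound (rank_leq_col _).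
Qed.
End Main.

Theorem theorem10 (R : realType) (g d : nat) (N : power_network R g d)
    (O : {set 'I_(g + d) * 'I_(g + d)}) (hO : is_orientation (line N) O)
    (alpha : 'cV[R]_(g + d).-1)
    (heq : is_equilibrium N (alpha, 0))
    (hunst : hyperbolic_unstable N O (alpha, 0)) :
  exists m : nat,
    unstable_of_type N O m (alpha, 0) /\
    (m <= #|critical_lines N (theta_of alpha)|)%N.
Proof.
exists (i_plus (J_dyn N O (theta_of alpha))); split; first by split.
exact: leq_trans (i_plus_J_dyn _ _ _) (count_negative_lines _ hO).
Qed.
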